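(* Let $m$ be a positive integer, let $A\in\mathbb{R}^{m\times m}$ have spectral radius $\rho(A)<1$, and let $B\in\mathbb{R}^{m\times p}$. Let $T:\mathcal{X}\to\mathbb{R}^m$ be a continuous map. Assume the following: 1. For all $x\in\mathcal{X}$ such that $f(x)\in\mathcal{X}$, $$T(f(x)) = A\,T(x) + B\,h(x).$$ 2. $T$ is uniformly injective, that is, there exists a class $\mathcal{K}^\infty$ function $\alpha$ such that for all $(x_1,x_2)\in\mathcal{X}^2$, $$|x_1-x_2|\le \alpha\big(|T(x_1)-T(x_2)|\big).$$ Then there exists a map $T^*:\mathbb{R}^m\to\mathbb{R}^n$ such that $(\hat X_k)_{k\ge 0}$, defined by $\hat X_k(x_0,\xi_0)=T^*(\Xi_k(x_0,\xi_0))$ for all $(x_0,\xi_0)\in\mathcal{X}_0\times\mathbb{R}^m$, is the solution of an observer for the system $x_{k+1}=f(x_k)$, $y_k=h(x_k)$; that is, the system $\xi_{k+1}=A\xi_k+By_k$, $\hat x_k=T^*(\xi_k)$ is an observer for it.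
   Context: Let $n,p$ be positive integers, and let $f:\mathbb{R}^n\to\mathbb{R}^n$ and $h:\mathbb{R}^n\to\mathbb{R}^p$ be functions. Consider the discrete-time system $x_{k+1}=f(x_k)$, $y_k=h(x_k)$, with state $x\in\mathbb{R}^n$ and output $y\in\mathbb{R}^p$. For $x_0\in\mathbb{R}^n$ and an integer $k\ge0$, write $X_k(x_0)=f^k(x_0)$ (the $k$-fold iterate of $f$ applied to $x_0$) and $Y_k(x_0)=h(X_k(x_0))$. Let $\mathcal{X}_0\subset\mathcal{X}\subset\mathbb{R}^n$ be sets such that $X_k(x_0)\in\mathcal{X}$ for all $x_0\in\mathcal{X}_0$ and all integers $k\ge 0$. $|\cdot|$ denotes the Euclidean norm. A class $\mathcal{K}^\infty$ function is a continuous, strictly increasing, unbounded function $\alpha:[0,+\infty)\to[0,+\infty)$ with $\alpha(0)=0$. For $(x_0,\xi_0)\in\mathcal{X}_0\times\mathbb{R}^m$, $\Xi_k(x_0,\xi_0)$ denotes the value at time $k$ of the solution of $\xi_{k+1}=A\xi_k+By_k$ with initial condition $\xi_0$ and with $y_k=Y_k(x_0)$. Definition (observer). Given a positive integer $m$ and functions $\varphi:\mathbb{R}^m\times\mathbb{R}^p\to\mathbb{R}^m$ and $\psi:\mathbb{R}^m\to\mathbb{R}^n$, the dynamical system $\xi_{k+1}=\varphi(\xi_k,y_k)$, $\hat x_k=\psi(\xi_k)$ is called an observer for $x_{k+1}=f(x_k)$, $y_k=h(x_k)$ if and only if, for all $(x_0,\xi_0)\in\mathcal{X}_0\times\mathbb{R}^m$,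 the solution $(X_k(x_0),\hat X_k(x_0,\xi_0))_{k\ge0}$ of the coupled system (with initial state $x_0$, initial observer state $\xi_0$ and $y_k=Y_k(x_0)$) satisfies $\lim_{k\to+\infty}|X_k(x_0)-\hat X_k(x_0,\xi_0)|=0$. *)

(* Defs.v *)
From mathcomp Require Import all_boot all_order all_algebra.
From mathcomp Require Import all_classical all_reals all_analysis.
From mathcomp Require Import complex.

Set Implicit Arguments.
Unset Strict Implicit.
Unset Printing Implicit Defensive.

Import Order.TTheory GRing.Theory Num.Theory.
Import numFieldNormedType.Exports.

Local Open Scope classical_set_scope.
Local Open Scope ring_scope.

(* The library norm on matrices is the sup norm, hence this definition. *)
Definition euclid_norm (R : realType) (n : nat) (v : 'cV[R]_n) : R :=
  Num.sqrt (\sum_(i < n) v i 0 ^+ 2).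

(* Largest modulus of a complex eigenvalue. For 0 < m the set is finite and
   nonempty, so that [sup] is its maximum. *)
Definition spectral_radius (R : realType) (m : nat) (A : 'M[R]_m) : R :=
  sup [set r : R | exists2 lambda : complex R,
    eigenvalue (map_mx (real_complex R) A) lambda
    & r = ComplexField.Normc.normc lambda].

(* A function on [0, +oo[ is represented by a total function on R of which
   only the values on [0, +oo[ matter. *)
Definition class_Kinfty (R : realType) (alpha : R -> R) : Prop :=
  [/\ forall s : R, 0 <= s -> 0 <= alpha s,
      alpha 0 = 0,
      {within [set s : R | 0 <= s], continuous alpha},
      forall s t : R, 0 <= s -> s < t -> alpha s < alpha t
    & forall M : R, exists2 s : R, 0 <= s & M < alpha s].

Definition uniformly_injective (R : realType) (n m : nat)
    (X : set 'cV[R]_n) (T : 'cV[R]_n -> 'cV[R]_m) : Prop :=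
  exists2 alpha : R -> R, class_Kinfty alpha &
    forall x1 x2 : 'cV[R]_n, X x1 -> X x2 ->
      euclid_norm (x1 - x2) <= alpha (euclid_norm (T x1 - T x2)).

Definition state_at (R : realType) (n : nat) (f : 'cV[R]_n -> 'cV[R]_n)
    (x0 : 'cV[R]_n) (k : nat) : 'cV[R]_n := iter k f x0.

Definition output_at (R : realType) (n p : nat)
    (f : 'cV[R]_n -> 'cV[R]_n) (h : 'cV[R]_n -> 'cV[R]_p)
    (x0 : 'cV[R]_n) (k : nat) : 'cV[R]_p := h (state_at f x0 k).

Fixpoint driven_solution (R : realType) (m p : nat)
    (phi : 'cV[R]_m -> 'cV[R]_p -> 'cV[R]_m) (y : nat -> 'cV[R]_p)
    (xi0 : 'cV[R]_m) (k : nat) : 'cV[R]_m :=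
  match k with
  | 0%N => xi0
  | k'.+1 => phi (driven_solution phi y xi0 k') (y k')
  end.

Definition is_observer (R : realType) (n p m : nat)
    (f : 'cV[R]_n -> 'cV[R]_n) (h : 'cV[R]_n -> 'cV[R]_p)
    (X0 : set 'cV[R]_n)
    (phi : 'cV[R]_m -> 'cV[R]_p -> 'cV[R]_m)
    (psi : 'cV[R]_m -> 'cV[R]_n) : Prop :=
  forall (x0 : 'cV[R]_n) (xi0 : 'cV[R]_m), X0 x0 ->
    (fun k : nat =>
       euclid_norm (state_at f x0 k
                    - psi (driven_solution phi (output_at f h x0) xi0 k)))
      @ \oo --> (0 : R).

(* Main.v *)
Require Import Defs.
From mathcomp Require Import all_boot all_order all_algebra.
From mathcomp Require Import all_classical all_reals all_analysis.
From mathcomp Require Import complex lra ring.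
Import Order.TTheory GRing.Theory Num.Theory.
Import numFieldNormedType.Exports.
Local Open Scope classical_set_scope.
Local Open Scope ring_scope.

(** Along a trajectory, the error T(x_k) - xi_k obeys e_(k+1) = A e_k, because
    T conjugates the plant to the linear filter; hence it equals A^k e_0, and
    it vanishes since the spectral radius of A is below 1
    ([cvg0_expmx]).  It remains to read the state off xi_k robustly, although
    xi_k need not lie in the image of T.  For this one needs a map S with

      |x - S xi| <= alpha (2 |T x - xi|)   for all x in X and all xi,

    which is [approximate_left_inverse]; continuity of alpha at 0 then
    concludes.

    For fixed xi, the condition on S xi says that it belongs to every closed
    ball centred at x in X with radius alpha (2 |T x - xi|).  By compactness it
    suffices that finitely many of these balls meet
    ([euclid_balls_common_point]); and the centre x' of the ball for which
    |T x' - xi| is least lies in all of them, since then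
    |T x - T x'| <= 2 |T x - xi| for every other centre x.

    For A^k -> 0, the characteristic polynomial of A splits over the complex
    numbers into factors X - lam with |lam| < 1, and annihilates A.  These
    factors are stripped one at a time: if (A - lam) q(A) A^k -> 0 then
    u_k = q(A) A^k satisfies u_(k+1) = lam u_k + o(1), so that u_k -> 0
    ([horner_mx_cvg0_factor]).  Once all the factors are gone, q = 1. *)

(** * Powers of a matrix of spectral radius less than 1 *)

Section LinearRecursion.
Context {R : realType}.
Implicit Types (a e : nat -> R) (lam : complex R).

(** Once e_k stays below eps/2 (1 - r), the bound eps/2 is a fixed point of the
    recursion, and the excess over it decays geometrically. *)
Lemma cvg0_perturbed_contraction (r : R) a e :
  0 <= r -> r < 1 -> (forall k, 0 <= a k) ->
  (forall k, a k.+1 <= r * a k + e k) ->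
  e @ \oo --> 0 -> a @ \oo --> 0.
Proof.
move=> r0 r1 a0 arec /cvgr0Pnorm_lt ecvg.
apply/cvgr0Pnorm_le => eps eps0.
have d0 : 0 < eps / 2 * (1 - r) by apply: mulr_gt0; lra.
have [N _ eN] := ecvg _ d0.
have aN k : a (k + N)%N <= a N * r ^+ k + eps / 2.
  elim: k => [|k IH]; first by rewrite expr0 add0n; lra.
  rewrite addSn; apply: (le_trans (arec _)).
  have /ltr_normlW ek := eN (k + N)%N (leq_addl _ _).
  have := ler_wpM2l r0 IH.
  rewrite exprS; move: ek; lra.
have /cvgr0Pnorm_lt gcvg : geometric (a N) r @ \oo --> 0.
  by apply: cvg_geometric; rewrite ger0_norm.
have [M _ gM] := gcvg (eps / 2) ltac:(lra).
exists (M + N)%N => // k /= MNk.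
have Nk : (N <= k)%N by apply: leq_trans MNk; apply: leq_addl.
have Mk : (M <= k - N)%N by rewrite leq_subRL// addnC.
have := gM _ Mk => /= /ltr_normlW gk.
by rewrite ger0_norm// -(subnK Nk); have := aN (k - N)%N; lra.
Qed.

Lemma normcD_le (x y : complex R) :
  ComplexField.Normc.normc (x + y) <=
  ComplexField.Normc.normc x + ComplexField.Normc.normc y.
Proof. exact: le_normcD. Qed.

Lemma normc_ge0 (x : complex R) : 0 <= ComplexField.Normc.normc x.
Proof. by case: x => ? ?; apply: sqrtr_ge0. Qed.

Lemma normc_real (x : R) :
  ComplexField.Normc.normc (real_complex R x) = `|x|.
Proof. by rewrite /= expr0n addr0 sqrtr_sqr. Qed.

(** The stripping step: X^(k+1) q = lam X^k q + (X - lam) X^k q makes each entry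
    of q(A) A^k a contraction perturbed by a vanishing term. *)
Lemma horner_mx_cvg0_factor (m : nat) (A : 'M[complex R]_m.+1)
    (q : {poly complex R}) lam i j :
  ComplexField.Normc.normc lam < 1 ->
  (fun k => ComplexField.Normc.normc
     (horner_mx A (q * ('X - lam%:P) * 'X^k) i j)) @ \oo --> (0 : R) ->
  (fun k => ComplexField.Normc.normc
     (horner_mx A (q * 'X^k) i j)) @ \oo --> (0 : R).
Proof.
move=> lam1; apply: cvg0_perturbed_contraction (normc_ge0 lam) lam1 _ _.
  by move=> k; apply: normc_ge0.
move=> k; rewrite -ComplexField.Normc.normcM.
apply: le_trans (normcD_le _ _); rewrite le_eqVlt; apply/orP; left; apply/eqP.
have -> : q * 'X^(k.+1) = lam%:P * (q * 'X^k) + q * ('X - lam%:P) * 'X^k.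
  by rewrite exprS; ring.
by rewrite mul_polyC rmorphD /= horner_mxZ !mxE.
Qed.

(** The set of eigenvalue moduli must be bounded for its supremum to carry any
    information. It is: the eigenvalues are among the
    finitely many roots of the characteristic polynomial, and the sum of the
    moduli of these is an upper bound. *)
Lemma eigenvalue_le_spectral_radius (m : nat) (A : 'M[R]_m) lam :
  eigenvalue (map_mx (real_complex R) A) lam ->
  ComplexField.Normc.normc lam <= spectral_radius A.
Proof.
move=> lamA; apply: ub_le_sup; last by exists lam.
have [rs cpE] := closed_field_poly_normal
  (char_poly (map_mx (real_complex R) A)).
exists (\sum_(mu <- rs) ComplexField.Normc.normc mu) => _ [mu muA ->].
have mu_rs : mu \in rs.
  move: muA; rewrite eigenvalue_root_char cpE rootZ ?root_prod_XsubC//.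
  by rewrite lead_coef_eq0 -size_poly_eq0 size_char_poly.
rewrite (big_rem mu)//= lerDl; apply: sumr_ge0 => ? _; exact: normc_ge0.
Qed.

Lemma cvg0_expmx (m : nat) (A : 'M[R]_m.+1) i j :
  spectral_radius A < 1 -> (fun k => (A ^+ k) i j) @ \oo --> 0.
Proof.
move=> rhoA; set AC := map_mx (real_complex R) A.
have [rs cpE] := closed_field_poly_normal (char_poly AC).
move: (cpE); rewrite (eqP (char_poly_monic AC)) scale1r => cpE1.
have rs_lt1 mu : mu \in rs -> ComplexField.Normc.normc mu < 1.
  move=> mu_rs; apply: le_lt_trans rhoA; apply: eigenvalue_le_spectral_radius.
  by rewrite eigenvalue_root_char cpE1 root_prod_XsubC.
have peel (s : seq (complex R)) : {subset s <= rs} ->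
    (fun k => ComplexField.Normc.normc
      (horner_mx AC (\prod_(mu <- s) ('X - mu%:P) * 'X^k) i j)) @ \oo
      --> (0 : R) ->
    (fun k => ComplexField.Normc.normc
      (horner_mx AC ('X^k) i j)) @ \oo --> (0 : R).
  elim: s => [|mu s IH] ss.
    by under eq_fun do rewrite big_nil mul1r.
  rewrite big_cons mulrC => /horner_mx_cvg0_factor cs.
  apply: IH => [nu nus|]; first by apply: ss; rewrite in_cons nus orbT.
  by apply: cs; apply/rs_lt1/ss; rewrite mem_head.
have Anorm : (fun k => `|(A ^+ k) i j|) @ \oo --> (0 : R).
  rewrite (_ : (fun k => _) = fun k => ComplexField.Normc.normc
      (horner_mx AC ('X^k) i j)); last first.
    apply/funext => k; rewrite rmorphXn /= horner_mx_X /AC.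
    by rewrite -rmorphXn /= mxE normc_real.
  apply: (peel rs) => //; rewrite -cpE1.
  rewrite (_ : (fun k => _) = fun=> 0); first exact: cvg_cst.
  apply/funext => k; rewrite rmorphM /= Cayley_Hamilton mul0r mxE.
  by rewrite ComplexField.Normc.normc0.
exact: norm_cvg0.
Qed.

End LinearRecursion.

(** * Families of closed Euclidean balls *)

Section EuclideanNorm.
Context {R : realType} {n : nat}.
Implicit Types (u v : 'cV[R]_n).

Lemma euclid_norm_ge0 v : 0 <= euclid_norm v.
Proof. exact: sqrtr_ge0. Qed.

(** Holds entrywise after squaring: (a - b)^2 <= 2 a^2 + 2 b^2. *)
Lemma euclid_normB_le u v (r : R) :
  euclid_norm u <= r -> euclid_norm v <= r -> euclid_norm (u - v) <= 2 * r.
Proof.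
move=> ur vr; have r0 : 0 <= r := le_trans (euclid_norm_ge0 u) ur.
have sq w : euclid_norm w <= r -> \sum_(i < n) w i 0 ^+ 2 <= r ^+ 2.
  move=> wr; rewrite -[leLHS]sqr_sqrtr.
    by rewrite lerXn2r ?nnegrE// euclid_norm_ge0.
  by apply: sumr_ge0 => i _; exact: sqr_ge0.
rewrite -(@ger0_norm _ (2 * r)) ?mulr_ge0// -sqrtr_sqr ler_wsqrtr//.
apply: (@le_trans _ _ (\sum_(i < n) (2 * u i 0 ^+ 2 + 2 * v i 0 ^+ 2))).
  apply: ler_sum => i _; rewrite !mxE.
  by have := sqr_ge0 (u i 0 + v i 0); lra.
rewrite big_split /= -!mulr_sumr.
by have := sq _ ur; have := sq _ vr; lra.
Qed.

Lemma coord_le_euclid_norm v i : `|v i 0| <= euclid_norm v.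
Proof.
rewrite -sqrtr_sqr ler_wsqrtr// (bigD1 i)//= lerDl.
by apply: sumr_ge0 => j _; exact: sqr_ge0.
Qed.

Lemma cvg_euclid_norm (T : Type) (F : set_system T) {FF : Filter F}
    (u : T -> 'cV[R]_n) (v : 'cV[R]_n) :
  (forall i, u x i 0 @[x --> F] --> v i 0) ->
  euclid_norm (u x) @[x --> F] --> euclid_norm v.
Proof.
move=> uv; apply: (continuous_cvg _ (@sqrt_continuous R _)).
apply: cvg_big => [|i _]; first exact: add_continuous.
exact: (continuous_cvg _ (@exprn_continuous R 2 _)).
Qed.

(** The points of the ball are written as row vectors because Tychonoff's
    theorem [rV_compact] concerns rows. *)
Lemma compact_euclid_ball (c : 'cV[R]_n) (r : R) :
  compact [set w : 'rV[R]_n | euclid_norm (c - w^T) <= r].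
Proof.
apply: (@subclosed_compact _ _
  [set w : 'rV[R]_n | forall i, `[c i 0 - r, c i 0 + r]%classic (w ord0 i)]).
- apply: (closed_comp (f := fun w : 'rV[R]_n => euclid_norm (c - w^T))
    (D := [set x | x <= r])); last exact: closed_le.
  move=> w _; apply: (@cvg_euclid_norm _ (nbhs w)) => i; rewrite !mxE.
  under eq_fun do rewrite !mxE.
  apply: cvgB; [exact: cvg_cst | exact: coord_continuous].
- apply: (@rV_compact _ _ (fun i => `[c i 0 - r, c i 0 + r]%classic)) => i.
  exact: segment_compact.
- move=> w /= wr i; rewrite in_itv /=.
  have := le_trans (coord_le_euclid_norm (c - w^T) i) wr.
  by rewrite !mxE ler_norml => /andP[? ?]; apply/andP; split; lra.
Qed.

(** By the finite intersection property, applied inside one of the balls. *)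
Lemma euclid_balls_common_point (X : set 'cV[R]_n) (r : 'cV[R]_n -> R) :
  (forall s : seq 'cV[R]_n, (forall x, x \in s -> X x) ->
     exists y, forall x, x \in s -> euclid_norm (x - y) <= r x) ->
  exists y, forall x, X x -> euclid_norm (x - y) <= r x.
Proof.
move=> fin.
have [[x1 Xx1]|X0] := pselect (exists x, X x); last first.
  by exists 0 => x Xx; case: X0; exists x.
pose ball x := [set w : 'rV[R]_n | euclid_norm (x - w^T) <= r x].
have := @compact_euclid_ball x1 (r x1); rewrite compact_In0.
move=> /(_ _ X (fun x => ball x1 `&` ball x)).
case=> [|D' D'X|w wball].
- exists ball => // x _; apply: compact_closed; last exact: compact_euclid_ball.
  exact: norm_hausdorff.
  (* x1 is added to the finite family so that the point found also lies in
     the ball that serves as the ambient compact set. *)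
- have [|y yball] := fin (x1 :: finmap.enum_fset D').
    by move=> x; rewrite in_cons => /predU1P[->//|/D'X]; rewrite inE.
  exists y^T => x /= xD'; split; rewrite /ball /= trmxK; apply: yball.
    by rewrite mem_head.
  by rewrite in_cons xD' orbT.
- by exists w^T => x Xx; have [] := wball x Xx.
Qed.

End EuclideanNorm.

(** * Approximate left inverse and convergence of the observer *)

Lemma seq_argmin {d} {T : eqType} {R : orderType d} (g : T -> R) (s : seq T) :
  s != [::] -> exists2 x, x \in s & forall y, y \in s -> (g x <= g y)%O.
Proof.
elim: s => // a [|b s] IH _.
  by exists a; rewrite ?mem_head// => y; rewrite inE => /eqP ->.
have [//|x xs xmin] := IH.
have [ax|xa] := leP (g a) (g x).
  exists a; rewrite ?mem_head// => y; rewrite in_cons => /predU1P[->//|ys].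
  exact: le_trans (xmin y ys).
exists x; first by rewrite in_cons xs orbT.
by move=> y; rewrite in_cons => /predU1P[->|/xmin//]; apply: ltW.
Qed.

(** A suitable value at xi is a common point of the closed balls with centre
    x in X and radius alpha (2 |T x - xi|). Any finitely many of them share the
    centre xm minimizing |T x - xi|, because
    |T x - T xm| <= |T x - xi| + |T xm - xi| <= 2 |T x - xi|. *)
Lemma approximate_left_inverse (R : realType) (n m : nat) (X : set 'cV[R]_n)
    (T : 'cV[R]_n -> 'cV[R]_m) (alpha : R -> R) :
  (forall s t, 0 <= s -> s <= t -> alpha s <= alpha t) ->
  (forall x1 x2, X x1 -> X x2 ->
     euclid_norm (x1 - x2) <= alpha (euclid_norm (T x1 - T x2))) ->
  exists S : 'cV[R]_m -> 'cV[R]_n, forall xi x, X x ->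
    euclid_norm (x - S xi) <= alpha (2 * euclid_norm (T x - xi)).
Proof.
move=> alphaW Tinj.
suff /choice[S Sapprox] : forall xi, exists y, forall x, X x ->
    euclid_norm (x - y) <= alpha (2 * euclid_norm (T x - xi)) by exists S.
move=> xi.
apply: euclid_balls_common_point => s sX.
have [->|s0] := eqVneq s [::]; first by exists 0.
have [xm xms xmin] := seq_argmin (fun x => euclid_norm (T x - xi)) _ s0.
exists xm => x xs; apply: le_trans (Tinj _ _ (sX _ xs) (sX _ xms)) _.
apply: alphaW; first exact: euclid_norm_ge0.
rewrite (_ : T x - T xm = (T x - xi) - (T xm - xi)); last first.
  by rewrite opprB addrA subrK.
by apply: euclid_normB_le => //; exact: xmin.
Qed.

Theorem theorem1 (R : realType) (n p m : nat)
    (n_gt0 : (0 < n)%N) (p_gt0 : (0 < p)%N) (m_gt0 : (0 < m)%N)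
    (f : 'cV[R]_n -> 'cV[R]_n) (h : 'cV[R]_n -> 'cV[R]_p)
    (X0 X : set 'cV[R]_n)
    (X0_sub_X : X0 `<=` X)
    (X_traj : forall (x0 : 'cV[R]_n) (k : nat), X0 x0 -> X (state_at f x0 k))
    (A : 'M[R]_m) (B : 'M[R]_(m, p))
    (rhoA_lt1 : spectral_radius A < 1)
    (T : 'cV[R]_n -> 'cV[R]_m)
    (T_cont : {within X, continuous T})
    (T_conj : forall x : 'cV[R]_n, X x -> X (f x) ->
       T (f x) = A *m T x + B *m h x)
    (T_inj : uniformly_injective X T) :
  exists Tstar : 'cV[R]_m -> 'cV[R]_n,
    is_observer f h X0
      (fun (xi : 'cV[R]_m) (y : 'cV[R]_p) => A *m xi + B *m y) Tstar.
Proof.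
case: m m_gt0 A B rhoA_lt1 T T_cont T_conj T_inj => // m _ A B rhoA T _ Tconj.
case=> alpha [_ alpha0 alpha_cont alpha_incr _] Tinj.
have alphaW (s t : R) : 0 <= s -> s <= t -> alpha s <= alpha t.
  move=> s0; rewrite le_eqVlt => /predU1P[->//|st].
  by rewrite ltW// alpha_incr.
have [S Sapprox] := @approximate_left_inverse _ _ _ _ _ _ alphaW Tinj.
exists S => x0 xi0 X0x0; set xi := driven_solution _ _ _; set x := state_at f x0.
have Xx k : X (x k) by exact: X_traj.
have err k : T (x k) - xi k = A ^+ k *m (T x0 - xi0).
  elim: k => [|k IH]; first by rewrite expr0 mul1mx.
  have -> : T (x k.+1) = A *m T (x k) + B *m h (x k).
    exact: (Tconj _ (Xx k) (Xx k.+1)).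
  rewrite exprS -[_ * _]/(_ *m _) -mulmxA -IH mulmxBr /= /output_at -/x.
  by rewrite opprD addrACA subrr addr0.
have err0 : (fun k => euclid_norm (T (x k) - xi k)) @ \oo --> (0 : R).
  have -> : 0 = euclid_norm (0 : 'cV[R]_m.+1).
    by rewrite /euclid_norm big1 ?sqrtr0// => i _; rewrite mxE expr0n.
  apply: cvg_euclid_norm => i; rewrite mxE.
  under eq_fun do rewrite err mxE.
  have : (fun k => \sum_(j < m.+1) (A ^+ k) i j * (T x0 - xi0) j 0) @ \oo
      --> \sum_(j < m.+1) (0 : R).
    apply: cvg_big => [|j _]; first exact: add_continuous.
    rewrite -[X in _ --> X](mul0r ((T x0 - xi0) j 0)).
    apply: cvgM; [exact: cvg0_expmx | exact: cvg_cst].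
  by rewrite big1.
have alpha_err : (fun k => alpha (2 * euclid_norm (T (x k) - xi k))) @ \oo
    --> (0 : R).
  apply/cvgr0Pnorm_lt => eps eps0.
  have nneg0 : [set s : R | 0 <= s] 0 by rewrite /=.
  have /subspace_continuousP/(_ 0 nneg0) := alpha_cont.
  rewrite /from_subspace alpha0 => /cvgr0Pnorm_lt /(_ _ eps0).
  rewrite near_withinE => /nbhs_ballP[d /= d0 dalpha].
  move/cvgr0Pnorm_lt : err0 => /(_ (d / 2) ltac:(lra)) [N _ errN].
  exists N => // k /= Nk; apply: dalpha; last by rewrite /= mulr_ge0// euclid_norm_ge0.
  have := errN k Nk; rewrite /ball /= sub0r normrN normrM.
  by rewrite (ger0_norm (_ : 0 <= 2))//; lra.
apply: (squeeze_cvgr _ (cvg_cst 0) alpha_err).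
by near=> k; rewrite euclid_norm_ge0 Sapprox.
Unshelve. all: by end_near.
Qed.
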